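(* Let $P\subset\mathbb{R}^{k+n}$ be a monotone bundle with fiber $Q\subset\mathbb{R}^n$ and base $B\subset\mathbb{R}^k$, with inclusion map $i:\mathbb{R}^n\to\mathbb{R}^{k+n}$. Then $i(\mathcal{E}(Q))\subset\mathcal{E}(P)$. In particular, if $\mathcal{E}(Q)\ne\{0\}$ then $\mathcal{E}(P)\ne\{0\}$.
   Context: The Ewald set of a polytope $P\subset\mathbb{R}^n$ is $\mathcal{E}(P):=\mathbb{Z}^n\cap P\cap(-P)$. An $n$-dimensional polytope in $\mathbb{R}^n$ is smooth if it is simple, rational, and the primitive edge-direction vectors at each vertex form a basis of $\mathbb{Z}^n$. A lattice polytope with the origin in its interior is reflexive if every facet-defining inequality is of the form $u_F\cdot x\le1$ with $u_F$ the primitive integer exterior normal of the facet; monotone means smooth and reflexive. Two polytopes are normally isomorphic if they have the same normal fan. $P\subset\mathbb{R}^{k+n}$ is a bundle with base $B\subset\mathbb{R}^k$ and fiber $Q\subset\mathbb{R}^n$ if (i) $P$ is combinatorially equivalent to $B\times Q$, and (ii) there is a short exact sequence of linear maps $0\to\mathbb{R}^n\xrightarrow{i}\mathbb{R}^{k+n}\xrightarrow{\pi}\mathbb{R}^k\to0$ such that $\pi(P)=B$ and for every $x\in B$ the polytope $\pi^{-1}(x)\cap P$ is normally isomorphic to $i(Q)$. Conventions: all bundles are unimodular, i.e. $i$ and $\pi$ become, after unimodular changes of coordinates, the standard inclusion and projection with respect to the integer lattices; and if $0\in B$ (as is the case here), then $i(Q)=\pi^{-1}(0)\cap P$. *)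

(* Defs.v *)
From HB Require Import structures.
From mathcomp Require Import all_boot all_order all_algebra.
From mathcomp Require Import boolp classical_sets functions cardinality.
From mathcomp Require Import reals topology.
Set Implicit Arguments.
Unset Strict Implicit.
Unset Printing Implicit Defensive.
Import Order.TTheory GRing.Theory Num.Theory.
Import numFieldTopology.Exports.
Local Open Scope classical_set_scope.
Local Open Scope ring_scope.

(* Points of R^n are row vectors. *)

Definition toR (R : realType) (n : nat) (z : 'rV[int]_n) : 'rV[R]_n :=
  map_mx intr z.
Arguments toR R {n} z.

Definition integer_lattice (R : realType) (n : nat) : set 'rV[R]_n :=
  range (@toR R n).

Definition ewald (R : realType) (n : nat) (P : set 'rV[R]_n) : set 'rV[R]_n :=
  @integer_lattice R n `&` P `&` [set - x | x in P].

Definition dot (R : realType) (n : nat) (u x : 'rV[R]_n) : R :=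
  \sum_(j < n) u 0 j * x 0 j.

Definition convex_hull (R : realType) (n m : nat) (p : 'I_m -> 'rV[R]_n) :
    set 'rV[R]_n :=
  [set x | exists c : 'I_m -> R,
     [/\ forall j, 0 <= c j, \sum_(j < m) c j = 1
       & x = \sum_(j < m) c j *: p j]].

Definition is_polytope (R : realType) (n : nat) (P : set 'rV[R]_n) : Prop :=
  exists (m : nat) (p : 'I_m -> 'rV[R]_n), P = convex_hull p.

(* The row [x0] together with the rows of [M] translated by [x0] is an affine
   basis of the affine hull of [F], consisting of points of [F].  The empty
   set has no dimension in this sense. *)
Definition has_dim (R : realType) (n : nat) (F : set 'rV[R]_n) (d : nat) :
    Prop :=
  exists (x0 : 'rV[R]_n) (M : 'M[R]_(d, n)),
    [/\ F x0, forall j, F (x0 + row j M), row_free M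
      & forall x, F x -> (x - x0 <= M)%MS].

(* The empty set and [P] itself are faces. *)
Definition is_face (R : realType) (n : nat) (P F : set 'rV[R]_n) : Prop :=
  exists (u : 'rV[R]_n) (c : R),
    (forall x, P x -> dot u x <= c) /\ F = P `&` [set x | dot u x = c].

Definition is_vertex (R : realType) (n : nat) (P : set 'rV[R]_n)
    (v : 'rV[R]_n) : Prop :=
  is_face P [set v].

Definition is_edge (R : realType) (n : nat) (P E : set 'rV[R]_n) : Prop :=
  is_face P E /\ has_dim E 1.

Definition is_facet (R : realType) (n : nat) (P F : set 'rV[R]_n) : Prop :=
  is_face P F /\ exists2 d, d.+1 = n & has_dim F d.

Definition simple_polytope (R : realType) (n : nat) (P : set 'rV[R]_n) :
    Prop :=
  forall v, is_vertex P v -> ([set E | is_edge P E /\ E v] #= `I_n)%card.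

Definition rational_polytope (R : realType) (n : nat) (P : set 'rV[R]_n) :
    Prop :=
  forall E, is_edge P E -> exists w : 'rV[int]_n,
    forall x y, E x -> E y -> exists t : R, y - x = t *: toR R w.

Definition primitive (n : nat) (w : 'rV[int]_n) : Prop :=
  \big[gcdn/0%N]_(j < n) absz (w 0 j) = 1%N.

Definition primitive_edge_direction (R : realType) (n : nat)
    (P : set 'rV[R]_n) (v : 'rV[R]_n) (w : 'rV[int]_n) : Prop :=
  primitive w /\ exists E, [/\ is_edge P E, E v
    & exists2 t : R, 0 < t & E (v + t *: toR R w)].

Definition is_Zbasis (n : nat) (W : 'M[int]_n) : Prop :=
  forall z : 'rV[int]_n, exists! c : 'rV[int]_n, z = c *m W.

Definition smooth (R : realType) (n : nat) (P : set 'rV[R]_n) : Prop :=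
  [/\ is_polytope P, has_dim P n, simple_polytope P, rational_polytope P
    & forall v, is_vertex P v -> exists W : 'M[int]_n, is_Zbasis W /\
        forall w, primitive_edge_direction P v w <-> exists j, w = row j W].

Definition lattice_polytope (R : realType) (n : nat) (P : set 'rV[R]_n) :
    Prop :=
  is_polytope P /\ forall v, is_vertex P v -> @integer_lattice R n v.

Definition reflexive_polytope (R : realType) (n : nat) (P : set 'rV[R]_n) :
    Prop :=
  [/\ lattice_polytope P, interior P 0
    & forall F, is_facet P F -> exists u : 'rV[int]_n,
        [/\ primitive u, forall x, P x -> dot (toR R u) x <= 1
          & F = P `&` [set x | dot (toR R u) x = 1]]].

Definition monotone (R : realType) (n : nat) (P : set 'rV[R]_n) : Prop :=
  smooth P /\ reflexive_polytope P.

(* Outer normal cone. *)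
Definition normal_cone (R : realType) (n : nat) (P F : set 'rV[R]_n) :
    set 'rV[R]_n :=
  [set u | forall x y, F x -> P y -> dot u y <= dot u x].

(* Defined in the dual of the ambient space also when [P] is not
   full-dimensional, in which case all cones share a lineality space. *)
Definition normal_fan (R : realType) (n : nat) (P : set 'rV[R]_n) :
    set (set 'rV[R]_n) :=
  [set normal_cone P F | F in [set F | is_face P F /\ F !=set0]].

Definition normally_isomorphic (R : realType) (n : nat)
    (P Q : set 'rV[R]_n) : Prop :=
  normal_fan P = normal_fan Q.

(* Isomorphism of face lattices. *)
Definition combinatorially_equivalent (R : realType) (m n : nat)
    (P : set 'rV[R]_m) (Q : set 'rV[R]_n) : Prop :=
  exists2 f : set 'rV[R]_m -> set 'rV[R]_n,
    set_bij (is_face P) (is_face Q) f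
    & forall F G, is_face P F -> is_face P G -> (F `<=` G <-> f F `<=` f G).

Definition product_polytope (R : realType) (k n : nat)
    (B : set 'rV[R]_k) (Q : set 'rV[R]_n) : set 'rV[R]_(k + n) :=
  [set x | B (lsubmx x) /\ Q (rsubmx x)].

Definition short_exact (R : realType) (k n : nat)
    (i : {linear 'rV[R]_n -> 'rV[R]_(k + n)})
    (pi : {linear 'rV[R]_(k + n) -> 'rV[R]_k}) : Prop :=
  [/\ injective i, range i = pi @^-1` [set 0] & range pi = [set: 'rV[R]_k]].

(* Unimodular changes of coordinates [A], [M], [C] of R^n, R^(k+n), R^k turn
   [i] into y |-> (0, y) and [pi] into (x, y) |-> x. *)
Definition unimodular_sequence (R : realType) (k n : nat)
    (i : {linear 'rV[R]_n -> 'rV[R]_(k + n)})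
    (pi : {linear 'rV[R]_(k + n) -> 'rV[R]_k}) : Prop :=
  exists (A : 'M[int]_n) (M : 'M[int]_(k + n)) (C : 'M[int]_k),
    [/\ A \in unitmx, M \in unitmx, C \in unitmx,
        forall y, i (y *m map_mx intr A) *m map_mx intr M = row_mx 0 y
      & forall z, pi z *m map_mx intr C = lsubmx (z *m map_mx intr M)].

Definition bundle (R : realType) (k n : nat)
    (P : set 'rV[R]_(k + n)) (B : set 'rV[R]_k) (Q : set 'rV[R]_n)
    (i : {linear 'rV[R]_n -> 'rV[R]_(k + n)})
    (pi : {linear 'rV[R]_(k + n) -> 'rV[R]_k}) : Prop :=
  [/\ is_polytope P, is_polytope B & is_polytope Q] /\
  [/\ combinatorially_equivalent P (product_polytope B Q),
      short_exact i pi /\ unimodular_sequence i pi,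
      pi @` P = B,
      forall x, B x -> normally_isomorphic (pi @^-1` [set x] `&` P) (i @` Q)
    & B 0 -> i @` Q = pi @^-1` [set 0] `&` P].

(* Main.v *)
Require Import Defs.
From mathcomp Require Import all_boot all_order all_algebra.
From mathcomp Require Import boolp classical_sets functions cardinality.
From mathcomp Require Import reals topology.
Import GRing.Theory.
Local Open Scope classical_set_scope.
Local Open Scope ring_scope.

(** Since [0] is interior to [P], it lies in [B = pi(P)], so the normalization
    of bundles makes [i(Q)] the fibre of [P] over [0]; in particular [i(Q)] is
    contained in [P]. As [i] is linear, a symmetric pair [y], [-y] of points
    of [Q] goes to a symmetric pair of points of [P], and as the bundle is
    unimodular, [i] sends lattice points to lattice points
    ([unimodular_inclusion_lattice]). The second claim follows from the
    first: [i] is injective, and [0] lies in [ewald Q] because the fibre over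
    [0] contains the origin. *)

(** In the unimodular coordinates [i] is [y |-> (0, y)], which is integral;
    going back to the standard coordinates stays integral because the inverse
    of an integer matrix that is a unit over the integers is again integral. *)
Lemma unimodular_inclusion_lattice (R : realType) (k n : nat)
    (i : {linear 'rV[R]_n -> 'rV[R]_(k + n)})
    (pi : {linear 'rV[R]_(k + n) -> 'rV[R]_k}) (y : 'rV[R]_n) :
  unimodular_sequence i pi ->
  @integer_lattice R n y -> @integer_lattice R (k + n) (i y).
Proof.
move=> [A [M [_ [A_unit M_unit _ iE _]]]] [z _ <-].
exists (row_mx 0 (z *m invmx A) *m invmx M) => //.
have zE : toR R z = toR R (z *m invmx A) *m map_mx intr A.
  by rewrite /toR -map_mxM mulmxKV.
have MV : map_mx intr M *m map_mx intr (invmx M) = 1%:M :> 'M[R]_(k + n).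
  by rewrite -map_mxM mulmxV // map_mx1.
by rewrite zE -[RHS]mulmx1 -MV mulmxA iE /toR map_mxM map_row_mx map_mx0.
Qed.

Lemma bundle_fiber0 {R : realType} {k n : nat}
    {P : set 'rV[R]_(k + n)} {B : set 'rV[R]_k} {Q : set 'rV[R]_n}
    {i : {linear 'rV[R]_n -> 'rV[R]_(k + n)}}
    { pi : {linear 'rV[R]_(k + n) -> 'rV[R]_k}} :
  bundle P B Q i pi -> P 0 -> i @` Q = pi @^-1` [set 0] `&` P.
Proof.
by move=> [_ [_ _ piP _ fiber0]] P0; apply: fiber0; rewrite -piP; exists 0;
  rewrite ?linear0.
Qed.

Lemma ewald_bundle_sub {R : realType} {k n : nat}
    {P : set 'rV[R]_(k + n)} {B : set 'rV[R]_k} {Q : set 'rV[R]_n}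
    {i : {linear 'rV[R]_n -> 'rV[R]_(k + n)}}
    { pi : {linear 'rV[R]_(k + n) -> 'rV[R]_k}} :
  bundle P B Q i pi -> P 0 -> i @` ewald Q `<=` ewald P.
Proof.
move=> hb P0.
have iQP y : Q y -> P (i y).
  move=> Qy; have : (i @` Q) (i y) by exists y.
  by rewrite (bundle_fiber0 hb P0) => -[].
have [_ [_ [_ unimod] _ _ _]] := hb.
move=> _ [y [[lat_y Qy] [x Qx yE]] <-].
split; first split.
- exact: unimodular_inclusion_lattice unimod lat_y.
- exact: iQP.
- by exists (i x); [exact: iQP | rewrite -yE linearN].
Qed.

Lemma ewald0 (R : realType) (n : nat) (P : set 'rV[R]_n) :
  P 0 -> ewald P 0.
Proof.
move=> P0; split; last by exists 0; rewrite ?oppr0.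
by split=> //; exists 0 => //; rewrite /toR map_mx0.
Qed.

Theorem proposition5p8 (R : realType) (k n : nat)
  (P : set 'rV[R]_(k + n)) (B : set 'rV[R]_k) (Q : set 'rV[R]_n)
  (i : {linear 'rV[R]_n -> 'rV[R]_(k + n)})
  (pi : {linear 'rV[R]_(k + n) -> 'rV[R]_k})
  (hP : monotone P) (hb : bundle P B Q i pi) :
  i @` ewald Q `<=` ewald P /\ (ewald Q <> [set 0] -> ewald P <> [set 0]).
Proof.
have P0 : P 0 by case: hP => _ [_ /interior_subset].
have sub := ewald_bundle_sub hb P0.
split=> // EQ_nontriv EP0; apply: EQ_nontriv.
have [_ [_ [[i_inj _ _] _] _ _ _]] := hb.
apply/seteqP; split=> [y EQy | _ ->].
  have : ewald P (i y) by apply: sub; exists y.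
  by rewrite EP0 /= -(linear0 i) => /i_inj.
apply: ewald0.
have : (i @` Q) 0 by rewrite (bundle_fiber0 hb P0); split; rewrite //= linear0.
by case=> y Qy; rewrite -(linear0 i) => /i_inj <-.
Qed.
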